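(* Let $0\le\epsilon<1/\sqrt2$ and $\epsilon'=\sqrt2\,\epsilon$. Let $\Phi\colon\mathbb{R}^{2n}\to\mathbb{R}^{2n}$ be a linear map that is $\epsilon$-symplectic, i.e. $\|\Phi^*\omega_0-\omega_0\|_2\le\epsilon$. Then $\Phi$ has the linear $\epsilon'$-non-squeezing property and the linear $\epsilon'$-non-expanding property.
   Context: $\mathbb{R}^{2n}$ carries the standard metric and the standard symplectic form $\omega_0=\sum_{j=1}^n dx_j\wedge dy_j$. For a two-form with constant coefficients, $\|\cdot\|_2$ is the Euclidean norm of its coefficient vector in the basis of wedge products (with increasing indices) of the standard orthonormal coframe. $\|A\|$ is the operator norm of a matrix. $B_r^{2n}$ is the closed ball of radius $r$ centered at the origin. For a non-singular real $2n\times2n$ matrix $A$, $E(A)=AB_1^{2n}$ is the associated ellipsoid centered at the origin. For each such $E(A)$ there is a linear symplectic map $\Psi$ with $\Psi E(A)=\{z\in\mathbb{C}^n\mid\sum_j|z_j/r_j|^2\le1\}$ for a unique tuple $0<r_1\le\dots\le r_n$ (where $\mathbb{R}^{2n}=\mathbb{C}^n$, $z_j=x_j+iy_j$); this tuple is the symplectic spectrum of $E(A)$ and $r_1$ is its linear symplectic width. Definition. Let $0\le\epsilon<1$ and $\rho=\sqrt{1-\epsilon}$. For a non-singular matrix $A$ let $r_A>0$ be the smallest number with $E(A)\subset B_{r_A}^{2n}$, let $s_A=(1+\|A^{-1}\|(\rho^{-1}-1)r_A)^{-1}$, and, if $\|A^{-1}\|(\rho^{-1}-1)r_A<1$, let $e_A=(1-\|A^{-1}\|(\rho^{-1}-1)r_A)^{-1}$.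 (a) A linear map $\Phi$ has the linear $\epsilon$-non-squeezing property if for every ellipsoid $E(A)$ with linear symplectic width $r_1$, the linear symplectic width $R_1$ of $\Phi E(A)$ satisfies $s_A r_1\le R_1$. (b) $\Phi$ has the linear $\epsilon$-non-expanding property if for every $r>0$ the linear symplectic width of $\Phi B_r^{2n}$ is at most $\rho^{-1}r$, and moreover for every ellipsoid $E(A)$ with linear symplectic width $r_1$ and $\|A^{-1}\|(\rho^{-1}-1)r_A<1$, the linear symplectic width $R_1$ of $\Phi E(A)$ satisfies $R_1\le e_A r_1$. (In the proposition these are applied with $\epsilon'$ in place of $\epsilon$.) *)

(* Defs.v *)
From HB Require Import structures.
From mathcomp Require Import all_boot all_order all_algebra.
From mathcomp Require Import all_classical all_reals.

Set Implicit Arguments.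
Unset Strict Implicit.
Unset Printing Implicit Defensive.

Import Order.TTheory GRing.Theory Num.Theory.

Local Open Scope classical_set_scope.
Local Open Scope ring_scope.

(* R^{2n} is 'cV[R]_(n + n) with coordinates (x_1, .., x_n, y_1, .., y_n). *)
Definition xcoord (R : realType) (n : nat) (v : 'cV[R]_(n + n)) (j : 'I_n) : R :=
  v (lshift n j) 0.

Definition ycoord (R : realType) (n : nat) (v : 'cV[R]_(n + n)) (j : 'I_n) : R :=
  v (rshift n j) 0.

(* The Euclidean norm; the norm that MathComp-Analysis puts on matrices is the
   sup norm. *)
Definition enorm (R : realType) (m : nat) (v : 'cV[R]_m) : R :=
  Num.sqrt (\sum_(i < m) v i 0 ^+ 2).

Definition eball (R : realType) (m : nat) (r : R) : set 'cV[R]_m :=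
  [set v | enorm v <= r].

Definition opnorm (R : realType) (m : nat) (A : 'M[R]_m) : R :=
  sup [set enorm (A *m v) | v in @eball R m 1].

(* A constant-coefficient two-form on R^m is given by its values on pairs of
   vectors. *)
Definition two_form (R : realType) (m : nat) : Type :=
  'cV[R]_m -> 'cV[R]_m -> R.

Definition omega0 (R : realType) (n : nat) : two_form R (n + n) :=
  fun u v => \sum_(j < n) (xcoord u j * ycoord v j - ycoord u j * xcoord v j).

Definition pullback (R : realType) (m : nat)
    (Phi : {linear 'cV[R]_m -> 'cV[R]_m}) (w : two_form R m) : two_form R m :=
  fun u v => w (Phi u) (Phi v).

(* The coefficient of w on the wedge of the i-th and k-th coframe elements is
   the value of w on the i-th and k-th standard basis vectors. *)
Definition two_form_norm (R : realType) (m : nat) (w : two_form R m) : R :=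
  Num.sqrt (\sum_(i < m) \sum_(k < m | (i < k)%N)
              w (delta_mx i 0) (delta_mx k 0) ^+ 2).

Definition symplectic (R : realType) (n : nat)
    (Psi : {linear 'cV[R]_(n + n) -> 'cV[R]_(n + n)}) : Prop :=
  pullback Psi (@omega0 R n) = @omega0 R n.

Definition eps_symplectic (R : realType) (n : nat) (eps : R)
    (Phi : {linear 'cV[R]_(n + n) -> 'cV[R]_(n + n)}) : Prop :=
  two_form_norm (fun u v => pullback Phi (@omega0 R n) u v - omega0 u v) <= eps.

Definition ellipsoid (R : realType) (m : nat) (A : 'M[R]_m) : set 'cV[R]_m :=
  [set A *m v | v in @eball R m 1].

(* |z_j / r_j|^2 = (x_j / r_j)^2 + (y_j / r_j)^2 *)
Definition std_ellipsoid (R : realType) (n : nat) (r : n.-tuple R) :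
    set 'cV[R]_(n + n) :=
  [set z | \sum_(j < n) ((xcoord z j / tnth r j) ^+ 2
                         + (ycoord z j / tnth r j) ^+ 2) <= 1].

Definition is_symplectic_spectrum (R : realType) (n : nat)
    (E : set 'cV[R]_(n + n)) (r : n.-tuple R) : Prop :=
  [/\ forall j, 0 < tnth r j,
      sorted <=%R r
    & exists2 Psi : {linear 'cV[R]_(n + n) -> 'cV[R]_(n + n)},
        symplectic Psi & Psi @` E = std_ellipsoid r].

(* r`_0 is the first entry of the spectrum (n > 0 is assumed in the theorem). *)
Definition is_linear_symplectic_width (R : realType) (n : nat)
    (E : set 'cV[R]_(n + n)) (w : R) : Prop :=
  exists2 r : n.-tuple R, is_symplectic_spectrum E r & w = r`_0.

(* "The linear symplectic width of E satisfies P", read as a definite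
   description: the width exists, is unique, and satisfies P. *)
Definition linear_symplectic_width_satisfies (R : realType) (n : nat)
    (E : set 'cV[R]_(n + n)) (P : R -> Prop) : Prop :=
  exists2 w : R, unique (is_linear_symplectic_width E) w & P w.

(* For nonsingular A (and m > 0) this infimum is attained and positive. *)
Definition outer_radius (R : realType) (m : nat) (A : 'M[R]_m) : R :=
  inf [set r | 0 < r /\ ellipsoid A `<=` @eball R m r].

Definition rho (R : realType) (eps : R) : R := Num.sqrt (1 - eps).

(* ||A^-1|| (rho^-1 - 1) r_A *)
Definition distortion (R : realType) (m : nat) (eps : R) (A : 'M[R]_m) : R :=
  opnorm (invmx A) * ((rho eps)^-1 - 1) * outer_radius A.

Definition squeeze_factor (R : realType) (m : nat) (eps : R) (A : 'M[R]_m) : R :=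
  (1 + distortion eps A)^-1.

Definition expand_factor (R : realType) (m : nat) (eps : R) (A : 'M[R]_m) : R :=
  (1 - distortion eps A)^-1.

Definition linear_non_squeezing (R : realType) (n : nat) (eps : R)
    (Phi : {linear 'cV[R]_(n + n) -> 'cV[R]_(n + n)}) : Prop :=
  forall (A : 'M[R]_(n + n)) (r1 : R),
    A \in unitmx ->
    is_linear_symplectic_width (ellipsoid A) r1 ->
    linear_symplectic_width_satisfies (Phi @` ellipsoid A)
      (fun R1 => squeeze_factor eps A * r1 <= R1).

Definition linear_non_expanding (R : realType) (n : nat) (eps : R)
    (Phi : {linear 'cV[R]_(n + n) -> 'cV[R]_(n + n)}) : Prop :=
  (forall r : R, 0 < r ->
     linear_symplectic_width_satisfies (Phi @` @eball R (n + n) r)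
       (fun R1 => R1 <= (rho eps)^-1 * r))
  /\
  (forall (A : 'M[R]_(n + n)) (r1 : R),
     A \in unitmx ->
     is_linear_symplectic_width (ellipsoid A) r1 ->
     distortion eps A < 1 ->
     linear_symplectic_width_satisfies (Phi @` ellipsoid A)
       (fun R1 => R1 <= expand_factor eps A * r1)).

(* Main.v *)
Require Import Defs.
From HB Require Import structures.
From mathcomp Require Import all_boot all_order all_algebra.
From mathcomp Require Import all_classical all_reals.
From mathcomp Require Import topology normedtype derive ring lra.

(** Write [J] for the matrix of the standard symplectic form.  To an ellipsoid
    [E(A)] attach the antisymmetric matrix [K = A^T J A].  The proof rests on
    the observation that the linear symplectic width [r_1] of [E(A)] satisfies:
    [r_1^2] is the least singular value of [K], that is, the minimum of
    [|K u| / |u|] over nonzero [u].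

    Indeed, by the normal form of real antisymmetric matrices there are an
    orthogonal [U] and a positive diagonal [D = diag(r, r)] with
    [U^T K U = D J D]; then [D U^T A^-1] is symplectic and carries [E(A)] onto
    the standard ellipsoid of radii [r] (lemma [williamson]).  Conversely, if a
    symplectic [Psi] carries [E(A)] onto a standard ellipsoid, then
    [Q = D^-1 Psi A] preserves the unit ball, so it is orthogonal, and
    [K = Q^T (D J D) Q] has the same singular values as [D J D], namely the
    [r_j^2] (lemma [spectrum_min_stretch]).  Existence and uniqueness of the
    width both follow.

    If [P] is the matrix of [Phi], then [P^T J P = J + M] where [M] is
    antisymmetric and [|M v| <= e |v|] with [e = sqrt 2 * eps < 1], because the
    Frobenius norm of an antisymmetric matrix is [sqrt 2] times the norm of its
    two-form.  The matrix attached to [Phi E(A) = E(P A)] is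
    [K' = A^T (J + M) A = K Y], where [Y = 1 - A^-1 J M A] since [J^-1 = - J].
    With [k = ||A^-1|| r_A], which is at least 1, one has
    [|Y u| <= (1 + k e) |u|] and [|u| <= (1 + k e / (1 - e)) |Y u|]
    (lemma [mx_perturbation]).
    Comparing least singular values of [K] and [K'] gives
    [r_1^2 <= (1 + k e / (1 - e)) R_1^2] and [R_1^2 <= (1 + k e) r_1^2].
    With [t = rho^-1 - 1] these imply both properties, as
    [1 + k e / (1 - e) <= (1 + k t)^2] (from [e / (1 - e) = t^2 + 2 t] and
    [1 <= k]) and [(1 - k t)^2 (1 + k e) <= 1] (from [e <= 2 t]). *)

Set Implicit Arguments.
Unset Strict Implicit.
Unset Printing Implicit Defensive.

Import Order.TTheory GRing.Theory Num.Theory.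
Import numFieldNormedType.Exports.

Local Open Scope classical_set_scope.
Local Open Scope ring_scope.

(** * The Euclidean inner product and norm *)

Definition dot (R : realType) (m : nat) (u v : 'cV[R]_m) : R := (u^T *m v) 0 0.

Section Dot.
Variables (R : realType) (m : nat).
Implicit Types (u v w : 'cV[R]_m) (a : R).

Lemma dotE u v : dot u v = \sum_i u i 0 * v i 0.
Proof. by rewrite /dot mxE; apply: eq_bigr => i _; rewrite mxE. Qed.

Lemma dotC u v : dot u v = dot v u.
Proof. by rewrite !dotE; apply: eq_bigr => i _; rewrite mulrC. Qed.

Lemma dotDr u v w : dot u (v + w) = dot u v + dot u w.
Proof. by rewrite /dot mulmxDr mxE. Qed.

Lemma dotZr u a v : dot u (a *: v) = a * dot u v.
Proof. by rewrite /dot -scalemxAr mxE. Qed.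

Lemma dotNr u v : dot u (- v) = - dot u v.
Proof. by rewrite /dot mulmxN mxE. Qed.

Lemma dotDl u v w : dot (v + w) u = dot v u + dot w u.
Proof. by rewrite dotC dotDr !(dotC u). Qed.

Lemma dotZl u a v : dot (a *: v) u = a * dot v u.
Proof. by rewrite dotC dotZr dotC. Qed.

Lemma dotNl u v : dot (- v) u = - dot v u.
Proof. by rewrite dotC dotNr dotC. Qed.

Definition dot_lin := (dotDl, dotDr, dotZl, dotZr, dotNl, dotNr).

Lemma dot_ge0 u : 0 <= dot u u.
Proof. by rewrite dotE sumr_ge0// => i _; rewrite -expr2 sqr_ge0. Qed.

Lemma dot_eq0 u : dot u u = 0 -> u = 0.
Proof.
move/eqP; rewrite dotE psumr_eq0 => [/allP h|i _]; last by rewrite -expr2 sqr_ge0.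
apply/matrixP => i j; rewrite ord1 mxE.
by have := h i (mem_index_enum _); rewrite mulf_eq0 orbb => /eqP.
Qed.

Lemma dot0r u : dot u 0 = 0.
Proof. by rewrite /dot mulmx0 mxE. Qed.

Lemma dot0l u : dot 0 u = 0.
Proof. by rewrite dotC dot0r. Qed.

Lemma enormE u : enorm u = Num.sqrt (dot u u).
Proof. by rewrite dotE. Qed.

Lemma sqr_enorm u : enorm u ^+ 2 = dot u u.
Proof. by rewrite enormE sqr_sqrtr // dot_ge0. Qed.

Lemma enorm_ge0 u : 0 <= enorm u.
Proof. by rewrite enormE sqrtr_ge0. Qed.

Lemma enorm0 : enorm (0 : 'cV[R]_m) = 0.
Proof. by rewrite enormE dot0l sqrtr0. Qed.

Lemma enorm_eq0 u : enorm u = 0 -> u = 0.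
Proof. by move=> h; apply: dot_eq0; rewrite -sqr_enorm h expr0n. Qed.

Lemma enorm_gt0 u : u != 0 -> 0 < enorm u.
Proof.
by rewrite lt0r enorm_ge0 andbT; apply: contraNneq => /enorm_eq0 ->.
Qed.

Lemma enormZ a u : enorm (a *: u) = `|a| * enorm u.
Proof.
by rewrite !enormE !dot_lin mulrA -expr2 sqrtrM ?sqr_ge0// sqrtr_sqr.
Qed.

Lemma enormN u : enorm (- u) = enorm u.
Proof. by rewrite !enormE !dot_lin opprK. Qed.

Lemma enorm_unit u : u != 0 -> enorm ((enorm u)^-1 *: u) = 1.
Proof.
move=> /enorm_gt0 h.
by rewrite enormZ ger0_norm ?invr_ge0 ?ltW// mulVf ?gt_eqF.
Qed.

Lemma cauchy_schwarz u v : dot u v ^+ 2 <= dot u u * dot v v.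
Proof.
have [->|u0] := eqVneq u 0; first by rewrite !dot0l expr0n mul0r.
have uu : 0 < dot u u by rewrite -sqr_enorm exprn_gt0 ?enorm_gt0.
have := dot_ge0 (dot u u *: v + (- dot u v) *: u).
rewrite !dot_lin (dotC v u) => h.
rewrite -subr_ge0 -(pmulr_rge0 _ uu); move: h; congr (0 <= _); ring.
Qed.

Lemma dot_le_enorm u v : dot u v <= enorm u * enorm v.
Proof.
rewrite (le_trans (ler_norm _))// -sqrtr_sqr !enormE -sqrtrM ?dot_ge0//.
by rewrite ler_wsqrtr ?cauchy_schwarz.
Qed.

Lemma enormD u v : enorm (u + v) <= enorm u + enorm v.
Proof.
rewrite -(ler_pXn2r (n := 2)) ?nnegrE ?enorm_ge0 ?addr_ge0 ?enorm_ge0//.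
rewrite sqrrD !sqr_enorm !dot_lin (dotC v u).
have := dot_le_enorm u v; lra.
Qed.

Lemma enormB u v : enorm (u - v) <= enorm u + enorm v.
Proof. by rewrite (le_trans (enormD _ _))// enormN. Qed.

Lemma delta_neq0 (i : 'I_m) : delta_mx i 0 != 0 :> 'cV[R]_m.
Proof.
by apply/eqP => /matrixP/(_ i 0)/eqP; rewrite !mxE !eqxx oner_eq0.
Qed.

End Dot.

(** * Matrices as operators between Euclidean spaces *)

Section Operators.
Variable R : realType.

Lemma dot_mulmxl m p (A : 'M[R]_(m, p)) u v :
  dot (A *m u) v = dot u (A^T *m v).
Proof. by rewrite /dot trmx_mul mulmxA. Qed.

Lemma dot_mulmxr m p (A : 'M[R]_(m, p)) u v :
  dot u (A *m v) = dot (A^T *m u) v.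
Proof. by rewrite dotC dot_mulmxl dotC. Qed.

Definition fnorm m p (A : 'M[R]_(m, p)) : R :=
  Num.sqrt (\sum_i \sum_j A i j ^+ 2).

Lemma enorm_mulmx_fnorm m p (A : 'M[R]_(m, p)) v :
  enorm (A *m v) <= fnorm A * enorm v.
Proof.
rewrite !enormE -sqrtrM; last first.
  by apply: sumr_ge0 => i _; apply: sumr_ge0 => j _; rewrite sqr_ge0.
apply: ler_wsqrtr; rewrite dotE mulr_suml; apply: ler_sum => i _.
have -> : (A *m v) i 0 = dot (row i A)^T v by rewrite /dot trmxK -row_mul [RHS]mxE.
have -> : \sum_j A i j ^+ 2 = dot (row i A)^T (row i A)^T.
  by rewrite dotE; apply: eq_bigr => j _; rewrite !mxE.
exact: cauchy_schwarz.
Qed.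

Lemma fnorm_ge0 m p (A : 'M[R]_(m, p)) : 0 <= fnorm A.
Proof. exact: sqrtr_ge0. Qed.

(** Homogeneity: a bound on the unit ball is a bound on the operator.  The
    operator norm and the outer radius are both controlled in this way. *)
Lemma ball_bound m (A : 'M[R]_m) b :
  (forall v, enorm v <= 1 -> enorm (A *m v) <= b) ->
  forall v, enorm (A *m v) <= b * enorm v.
Proof.
move=> h v; have [->|v0] := eqVneq v 0; first by rewrite mulmx0 !enorm0 mulr0.
have := h ((enorm v)^-1 *: v); rewrite enorm_unit // => /(_ (lexx _)).
rewrite -scalemxAr enormZ ger0_norm ?invr_ge0 ?enorm_ge0//.
by rewrite mulrC ler_pdivrMr ?enorm_gt0.
Qed.

Lemma enorm_mulmx_opnorm m (A : 'M[R]_m) v :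
  enorm (A *m v) <= opnorm A * enorm v.
Proof.
apply: ball_bound => {}v v1; apply: ub_le_sup; last by exists v.
exists (fnorm A) => _ [w w1 <-].
rewrite (le_trans (enorm_mulmx_fnorm _ _))// -[leRHS]mulr1.
by rewrite ler_wpM2l ?fnorm_ge0.
Qed.

Lemma enorm_mulmx_outer_radius m (A : 'M[R]_m) v :
  enorm (A *m v) <= outer_radius A * enorm v.
Proof.
apply: ball_bound => {}v v1; apply: lb_le_inf.
  (* The infimum has to be over a nonempty set; the summand 1 keeps the witness
     positive. *)
  exists (1 + fnorm A); split; first by rewrite ltr_pwDl ?fnorm_ge0.
  move=> _ [w w1 <-]; apply: (le_trans (enorm_mulmx_fnorm _ _)).
  rewrite (@le_trans _ _ (fnorm A))// ?ler_wpDl//.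
  by rewrite -[leRHS]mulr1 ler_wpM2l ?fnorm_ge0.
by move=> r [_]; apply; exists v.
Qed.

(** Since [outer_radius A] is the operator norm of [A], this is the fact that
    a condition number is at least 1. *)
Lemma opnorm_outer_ge1 m (A : 'M[R]_m) : (0 < m)%N -> A \in unitmx ->
  1 <= opnorm (invmx A) * outer_radius A.
Proof.
case: m A => // m A _ uA; have e0 := delta_neq0 R (ord0 : 'I_m.+1).
rewrite -(ler_pM2r (enorm_gt0 e0)) mul1r.
rewrite -{1}[delta_mx _ _](mulKmx uA) -mulrA.
rewrite (le_trans (enorm_mulmx_opnorm _ _))// ler_wpM2l//.
  have := enorm_mulmx_opnorm (invmx A) (delta_mx 0 0).
  by move/(le_trans (enorm_ge0 _)); rewrite pmulr_lge0 ?enorm_gt0.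
exact: enorm_mulmx_outer_radius.
Qed.

End Operators.

(** * Least stretching of a matrix on a kernel *)

Section Extremal.
Variable R : realType.

Lemma continuous_sum (T : topologicalType) (I : finType) (F : I -> T -> R) :
  (forall i, continuous (F i)) -> continuous (fun x => \sum_i F i x).
Proof.
move=> h; have addc := @add_continuous R^o.
exact: (continuous_big addc (P := xpredT) (fun i _ => h i)).
Qed.

Lemma continuous_quad m k (B : 'M[R]_(k, m)) :
  continuous (fun x : 'rV[R]_m => dot (B *m x^T) (B *m x^T)).
Proof.
have lin i : continuous (fun x : 'rV[R]_m => (B *m x^T) i 0).
  rewrite (_ : (fun _ => _) = fun x : 'rV[R]_m => \sum_j B i j * x 0 j); last first.
    by apply/funext => x; rewrite mxE; apply: eq_bigr => j _; rewrite mxE.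
  apply: continuous_sum => j x.
  have cB := @cvg_cst R (B i j) _ (nbhs x) (nbhs_filter x).
  exact: (@cvgM _ _ _ (nbhs_filter x) _ _ _ _ cB (@coord_continuous R 1 m 0 j x)).
rewrite (_ : (fun _ => _) = fun x : 'rV[R]_m =>
    \sum_i (B *m x^T) i 0 * (B *m x^T) i 0); last first.
  by apply/funext => x; rewrite dotE.
apply: continuous_sum => i x.
exact: (cvgM (lin i x) (lin i x)).
Qed.

(** The unit sphere of [ker Q] is compact, so [|K u|] attains its minimum on
    it. *)
Lemma constrained_min m p q (K : 'M[R]_(q, m)) (Q : 'M[R]_(p, m)) :
  (exists2 w : 'cV[R]_m, w != 0 & Q *m w = 0) ->
  exists u : 'cV[R]_m, [/\ Q *m u = 0, enorm u = 1 &
    forall w, Q *m w = 0 -> enorm (K *m u) * enorm w <= enorm (K *m w)].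
Proof.
move=> [w0 w0N0 Qw0].
pose S := [set x : 'rV[R]_m | dot (1%:M *m x^T) (1%:M *m x^T) = 1] `&`
  [set x : 'rV[R]_m | dot (Q *m x^T) (Q *m x^T) = 0].
have Sc : compact S.
  apply: (@subclosed_compact _ S
      [set x : 'rV[R]_m | forall i, `[-1, 1]%classic (x 0 i)]).
  - apply: closedI.
    + have /continuous_closedP closed_pre := @continuous_quad m m 1%:M.
      exact: (closed_pre _ (@closed_eq R 1)).
    + have /continuous_closedP closed_pre := @continuous_quad m p Q.
      exact: (closed_pre _ (@closed_eq R 0)).
  - exact: (@rV_compact R m (fun=> `[-1, 1]%classic)
      (fun=> @segment_compact R (-1) 1)).
  - move=> x [x1 _] i /=; rewrite in_itv /= -ler_norml.
    rewrite -(ler_pXn2r (n := 2)) ?nnegrE// expr1n real_normK ?num_real//.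
    rewrite -{}x1 mul1mx dotE (bigD1 i)//= mxE expr2 lerDl.
    by apply: sumr_ge0 => j _; rewrite -expr2 sqr_ge0.
have unitS (w : 'cV[R]_m) : enorm w = 1 -> Q *m w = 0 -> S w^T.
  by move=> w1 Qw; split; rewrite /= trmxK ?mul1mx -?sqr_enorm ?w1 ?Qw ?enorm0
     ?expr1n ?expr0n.
have unitQ (w : 'cV[R]_m) : Q *m w = 0 -> Q *m ((enorm w)^-1 *: w) = 0.
  by move=> Qw; rewrite -scalemxAr Qw scaler0.
have S0 : S !=set0.
  by exists ((enorm w0)^-1 *: w0)^T; apply: unitS; rewrite ?enorm_unit ?unitQ.
have [|x /set_mem[x1 Qx] xmin] := EVT_min_rV S0 Sc
    (f := fun x => dot (K *m x^T) (K *m x^T)).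
  by apply: continuous_subspaceT; exact: continuous_quad.
exists x^T; split; first exact: dot_eq0.
  by rewrite enormE; move: x1; rewrite /= mul1mx => ->; rewrite sqrtr1.
move=> w Qw; have [->|w1] := eqVneq w 0; first by rewrite mulmx0 !enorm0 mulr0.
rewrite -ler_pdivlMr ?enorm_gt0// mulrC.
rewrite -[X in X * _]ger0_norm ?invr_ge0 ?enorm_ge0// -enormZ scalemxAr.
have /xmin : ((enorm w)^-1 *: w)^T \in S.
  by apply/mem_set/unitS; rewrite ?enorm_unit ?unitQ.
by rewrite trmxK => h; rewrite [leLHS]enormE [leRHS]enormE ler_wsqrtr.
Qed.

End Extremal.

(** * Normal form of antisymmetric matrices *)

Section NormalForm.
Variable R : realType.

(** The first-order optimality condition, for perturbations [u + t w] of a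
    minimiser [u]. *)
Lemma nonneg_quadratic (g h : R) : 0 <= h ->
  (forall t, 0 <= t * g *+ 2 + t ^+ 2 * h) -> g = 0.
Proof.
(* At the minimiser [- g / h] the value is negative unless [g = 0]; the added 1
   avoids a case distinction on [h = 0]. *)
move=> h0 /(_ (- g / (h + 1))).
have h1 : 0 < h + 1 by rewrite ltr_wpDl.
have -> : - g / (h + 1) * g *+ 2 + (- g / (h + 1)) ^+ 2 * h =
    - (g ^+ 2 * (h + 2) / (h + 1) ^+ 2).
  by field; rewrite gt_eqF.
rewrite oppr_ge0 pmulr_lle0 ?invr_gt0 ?exprn_gt0// pmulr_lle0 ?ltr_wpDl//.
by move=> g2; apply/eqP; rewrite -sqrf_eq0 eq_le g2 sqr_ge0.
Qed.

Lemma antisym_dot m (K : 'M[R]_m) x y : K^T = - K ->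
  dot x (K *m y) = - dot (K *m x) y.
Proof. by move=> aK; rewrite dot_mulmxr aK mulNmx dotNl. Qed.

(** One step of the reduction, on a [K]-invariant subspace [ker Q].  Take [u]
    minimising [|K u|] over its unit sphere and [c] the minimum.  Optimality says
    that [K^T K u - c^2 u] is orthogonal to [ker Q]; it also lies in [ker Q], so
    it vanishes.  As [K^T = - K], [v = - c^-1 K u] completes [u] to an
    orthonormal basis of an invariant plane.  The minimality of [c] is kept so
    that the successive values come out sorted. *)
Lemma antisym_step m p (K : 'M[R]_m) (Q : 'M[R]_(p, m)) :
  K^T = - K -> K \in unitmx ->
  (forall w : 'cV[R]_m, Q *m w = 0 -> Q *m (K *m w) = 0) ->
  (exists2 w : 'cV[R]_m, w != 0 & Q *m w = 0) ->
  exists c (u v : 'cV[R]_m),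
    [/\ 0 < c, Q *m u = 0 /\ Q *m v = 0,
        [/\ dot u u = 1, dot v v = 1 & dot u v = 0],
        K *m u = - c *: v /\ K *m v = c *: u &
        forall w, Q *m w = 0 -> c * enorm w <= enorm (K *m w)].
Proof.
move=> aK uK QK /(@constrained_min R m p m K Q)[u [Qu u1 umin]].
pose c := enorm (K *m u).
have c0 : 0 < c.
  apply: enorm_gt0; apply/eqP => Ku0.
  by move/eqP: u1; rewrite -[u](mulKmx uK) Ku0 mulmx0 enorm0 eq_sym oner_eq0.
have uu : dot u u = 1 by rewrite -sqr_enorm u1 expr1n.
have crit w : Q *m w = 0 -> dot (K *m u) (K *m w) = c ^+ 2 * dot u w.
  move=> Qw; apply/eqP; rewrite -subr_eq0; apply/eqP.
  have le2 x : Q *m x = 0 -> c ^+ 2 * dot x x <= dot (K *m x) (K *m x).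
    move=> Qx; rewrite -!sqr_enorm -exprMn lerXn2r ?nnegrE ?enorm_ge0//.
      by rewrite mulr_ge0// enorm_ge0.
    exact: umin.
  apply: (@nonneg_quadratic _ (dot (K *m w) (K *m w) - c ^+ 2 * dot w w)).
    by rewrite subr_ge0 le2.
  move=> t; have := le2 (u + t *: w).
  rewrite mulmxDr -scalemxAr Qu Qw scaler0 addr0 => /(_ erefl).
  rewrite -subr_ge0 mulmxDr -scalemxAr !dot_lin (dotC w u) uu.
  rewrite -(sqr_enorm (K *m u)) -/c (dotC (K *m w) (K *m u)).
  by congr (0 <= _); ring.
(* [z] is in [ker Q] and, by [crit], orthogonal to all of [ker Q]. *)
have KKu : K *m (K *m u) = - c ^+ 2 *: u.
  apply/eqP; rewrite scaleNr -addr_eq0; apply/eqP/dot_eq0.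
  set z := (_ + _); have Qz : Q *m z = 0.
    by rewrite mulmxDr QK ?QK// -scalemxAr Qu scaler0 addr0.
  rewrite {1}/z dotDl dotZl dotC (antisym_dot _ _ aK).
  by rewrite [dot (K *m z) _]dotC (crit _ Qz) addNr.
exists c, u, (- c^-1 *: (K *m u)); split => //.
- by split => //; rewrite -scalemxAr QK ?scaler0.
- split => //.
    rewrite !dot_lin -(sqr_enorm (K *m u)) -/c; field; exact/lt0r_neq0.
  rewrite !dot_lin (_ : dot u _ = 0) ?mulr0//.
  have := antisym_dot u u aK; rewrite (dotC _ u); lra.
- rewrite -scalemxAr KKu !scalerA; split.
    by rewrite mulrNN divff ?scale1r// lt0r_neq0.
  by congr (_ *: _); field; exact/lt0r_neq0.
Qed.

Lemma kernel_nontrivial m p (Q : 'M[R]_(p, m)) : (\rank Q < m)%N ->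
  exists2 w : 'cV[R]_m, w != 0 & Q *m w = 0.
Proof.
move=> Qm; pose z := nz_row (kermx Q^T); exists z^T.
  by rewrite trmx_eq0 nz_row_eq0 -mxrank_eq0 mxrank_ker subn_eq0 -ltnNge mxrank_tr.
have /sub_kermxP zQ : (z <= kermx Q^T)%MS by exact: nz_row_sub.
by apply: (@trmx_inj); rewrite trmx_mul trmxK zQ trmx0.
Qed.

Lemma unitmx_inj m (A : 'M[R]_m) :
  (forall w : 'cV[R]_m, A *m w = 0 -> w = 0) -> A \in unitmx.
Proof.
move=> A0; rewrite -row_free_unit -row_leq_rank leqNgt; apply/negP.
by move=> /kernel_nontrivial[w /eqP w0 /A0].
Qed.

(** [k] invariant planes split off successively.  The families are indexed by
    [nat] so that they can be extended without changing their types.  The last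
    clause is the minimality of each [c i] on the complement of the preceding
    planes. *)
Definition antisym_frame m (K : 'M[R]_m) k (u v : nat -> 'cV[R]_m)
    (c : nat -> R) : Prop :=
  [/\ forall i, (i < k)%N -> 0 < c i,
      forall i j, (i < k)%N -> (j < k)%N ->
        [/\ dot (u i) (u j) = (i == j)%:R, dot (v i) (v j) = (i == j)%:R &
            dot (u i) (v j) = 0],
      forall i, (i < k)%N -> K *m u i = - c i *: v i /\ K *m v i = c i *: u i &
      forall i w, (i < k)%N ->
        (forall j, (j < i)%N -> dot (u j) w = 0 /\ dot (v j) w = 0) ->
        c i * enorm w <= enorm (K *m w)].

Lemma exists_antisym_frame n (K : 'M[R]_(n + n)) k :
  K^T = - K -> K \in unitmx -> (k <= n)%N ->
  exists u v c, antisym_frame K k u v c.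
Proof.
move=> aK uK; elim: k => [_|k IH kn].
  by exists (fun=> 0), (fun=> 0), (fun=> 0); split.
have [u [v [c [c0 orth Kuv cmin]]]] := IH (ltnW kn).
(* [ker Q] is the orthogonal complement of the planes found so far; it is
   nontrivial because [k + k < n + n]. *)
pose Q : 'M[R]_(k + k, n + n) :=
  col_mx (\matrix_(i < k) (u i)^T) (\matrix_(i < k) (v i)^T).
have rowsE (f : nat -> 'cV[R]_(n + n)) (w : 'cV[R]_(n + n)) (i : 'I_k) :
    ((\matrix_(i < k) (f i)^T) *m w) i 0 = dot (f i) w.
  by rewrite dotE mxE; apply: eq_bigr => j _; rewrite !mxE.
have QP w : Q *m w = 0 <->
    forall j, (j < k)%N -> dot (u j) w = 0 /\ dot (v j) w = 0.
  rewrite mul_col_mx; split => [/eqP|h].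
    rewrite col_mx_eq0 => /andP[/eqP/matrixP hu /eqP/matrixP hv] j jk.
    have := hu (Ordinal jk) 0; have := hv (Ordinal jk) 0.
    by rewrite !rowsE !mxE.
  apply/eqP; rewrite col_mx_eq0; apply/andP; split; apply/eqP/matrixP => i j;
    by rewrite ord1 rowsE mxE; have [] := h i (ltn_ord i).
have QK (w : 'cV[R]_(n + n)) : Q *m w = 0 -> Q *m (K *m w) = 0.
  move=> /QP h; apply/QP => j jk; have [uw vw] := h j jk.
  have [Ku Kv] := Kuv j jk.
  by rewrite !(antisym_dot _ _ aK) Ku Kv !dotZl uw vw !mulr0 oppr0.
have rkQ : (\rank Q < n + n)%N.
  exact: leq_ltn_trans (rank_leq_row Q) (leq_add kn (ltnW kn)).
have [a [x [y [a0 [/QP Qx /QP Qy] [xx yy xy] [Kx Ky] amin]]]] :=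
  antisym_step aK uK QK (kernel_nontrivial rkQ).
pose ext T (f : nat -> T) z i := if (i < k)%N then f i else z.
have extl T (f : nat -> T) z i : (i < k)%N -> ext T f z i = f i.
  by rewrite /ext => ->.
have extr T (f : nat -> T) z : ext T f z k = z by rewrite /ext ltnn.
have lastP i : (i < k.+1)%N -> i = k \/ (i < k)%N.
  by rewrite ltnS leq_eqVlt => /predU1P.
exists (ext _ u x), (ext _ v y), (ext _ c a); split.
- move=> i /lastP[->|ik]; first by rewrite extr.
  by rewrite extl ?c0.
- move=> i j /lastP[->|ik] /lastP[->|jk].
  + by rewrite !extr eqxx.
  + rewrite !extr !extl// gtn_eqF// !(dotC x) (dotC y).
    by have [-> _] := Qx j jk; have [_ ->] := Qy j jk; have [_ ->] := Qx j jk.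
  + rewrite !extr !extl// ltn_eqF//.
    by have [-> _] := Qx i ik; have [-> ->] := Qy i ik.
  + by rewrite !extl//; exact: orth.
- move=> i /lastP[->|ik]; first by rewrite !extr.
  by rewrite !extl//; exact: Kuv.
- move=> i w /lastP[->|ik] h.
    by rewrite extr; apply: amin; apply/QP => j jk; have := h j jk; rewrite !extl.
  rewrite extl//; apply: cmin => // j ji.
  by have := h j ji; rewrite !extl// (ltn_trans ji ik).
Qed.

End NormalForm.

(** * The symplectic form in matrix terms *)

Section Williamson.
Variables (R : realType) (n : nat).

Definition Jmx : 'M[R]_(n + n) := block_mx 0 1%:M (- 1%:M) 0.

Lemma omega0E (u v : 'cV[R]_(n + n)) : omega0 u v = dot u (Jmx *m v).
Proof.
rewrite /Jmx -[in RHS](vsubmxK v) mul_block_col !mul0mx mulNmx !mul1mx add0r addr0.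
rewrite dotE big_split_ord /= -big_split /=; apply: eq_bigr => j _.
by rewrite col_mxEu col_mxEd !mxE mulrN.
Qed.

Lemma trmx_Jmx : Jmx^T = - Jmx.
Proof.
by rewrite /Jmx tr_block_mx opp_block_mx !trmx0 !oppr0 linearN /= trmx1 opprK.
Qed.

Lemma Jmx_sqr : Jmx *m Jmx = - 1%:M.
Proof.
rewrite /Jmx mulmx_block !mul0mx !mulmx0 !mul1mx !mulmx1 !add0r !addr0.
by rewrite (@scalar_mx_block _ n n) opp_block_mx oppr0.
Qed.

Lemma Jmx_unit : Jmx \in unitmx.
Proof.
have /mulmx1_unit[] // : Jmx *m (- Jmx) = 1%:M.
by rewrite mulmxN Jmx_sqr opprK.
Qed.

Lemma enorm_Jmx (u : 'cV[R]_(n + n)) : enorm (Jmx *m u) = enorm u.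
Proof.
by rewrite !enormE dot_mulmxl trmx_Jmx mulNmx mulmxA Jmx_sqr mulNmx mul1mx opprK.
Qed.

Definition linmx m (f : {linear 'cV[R]_m -> 'cV[R]_m}) : 'M[R]_m :=
  \matrix_(i, j) f (delta_mx j 0) i 0.

Lemma linmxE m (f : {linear 'cV[R]_m -> 'cV[R]_m}) v : f v = linmx f *m v.
Proof.
have {1}-> : v = \sum_j v j 0 *: delta_mx j 0.
  apply/matrixP => i k; rewrite ord1 summxE (bigD1 i)//= big1 => [|j ji].
    by rewrite !mxE !eqxx mulr1 addr0.
  by rewrite !mxE eq_sym (negbTE ji) mulr0.
rewrite linear_sum; apply/matrixP => i k; rewrite ord1 summxE mxE.
by apply: eq_bigr => j _; rewrite linearZ !mxE mulrC.
Qed.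

Lemma bilinear_eq m (A B : 'M[R]_m) :
  (forall u v : 'cV[R]_m, dot u (A *m v) = dot u (B *m v)) -> A = B.
Proof.
move=> h; apply/matrixP => i j; have := h (delta_mx i 0) (delta_mx j 0).
by rewrite /dot trmx_delta -!colE -!rowE !mxE.
Qed.

Lemma symplecticP (Psi : {linear 'cV[R]_(n + n) -> 'cV[R]_(n + n)}) :
  symplectic Psi <-> (linmx Psi)^T *m Jmx *m linmx Psi = Jmx.
Proof.
have E u v : pullback Psi (@omega0 R n) u v =
    dot u (((linmx Psi)^T *m Jmx *m linmx Psi) *m v).
  by rewrite /pullback omega0E !(linmxE Psi) dot_mulmxl !mulmxA.
split=> [h|h]; first by apply: bilinear_eq => u v; rewrite -E h omega0E.
by apply/funext => u; apply/funext => v; rewrite E h omega0E.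
Qed.

(** The matrix [diag(r, r)], which maps the unit ball onto the standard ellipsoid
    of radii [r]. *)
Definition dbl (r : 'I_n -> R) : 'M[R]_(n + n) :=
  diag_mx (row_mx (\row_j r j) (\row_j r j)).

Lemma dbl_x r v j : xcoord (dbl r *m v) j = r j * xcoord v j.
Proof. by rewrite /xcoord /dbl mul_diag_mx mxE row_mxEl mxE. Qed.

Lemma dbl_y r v j : ycoord (dbl r *m v) j = r j * ycoord v j.
Proof. by rewrite /ycoord /dbl mul_diag_mx mxE row_mxEr mxE. Qed.

Lemma J_x v j : xcoord (Jmx *m v) j = ycoord v j.
Proof.
rewrite /xcoord /Jmx -{1}(vsubmxK v) mul_block_col col_mxEu mul0mx mul1mx add0r.
by rewrite mxE.
Qed.

Lemma J_y v j : ycoord (Jmx *m v) j = - xcoord v j.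
Proof.
rewrite /ycoord /Jmx -{1}(vsubmxK v) mul_block_col col_mxEd mul0mx addr0 mulNmx.
by rewrite mul1mx !mxE.
Qed.

Lemma xy_inj (u v : 'cV[R]_(n + n)) :
  (forall j, xcoord u j = xcoord v j) -> (forall j, ycoord u j = ycoord v j) ->
  u = v.
Proof.
move=> hx hy; apply/matrixP => i k; rewrite ord1.
by case: (split_ordP i) => j ->; [exact: hx|exact: hy].
Qed.

Lemma dot_xy (u v : 'cV[R]_(n + n)) :
  dot u v = \sum_j (xcoord u j * xcoord v j + ycoord u j * ycoord v j).
Proof. by rewrite dotE big_split_ord /= -big_split. Qed.

Lemma std_ellipsoidE (r : n.-tuple R) z :
  std_ellipsoid r z <-> enorm (dbl (fun j => (tnth r j)^-1) *m z) <= 1.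
Proof.
rewrite -(ler_pXn2r (n := 2)) ?nnegrE ?enorm_ge0// expr1n sqr_enorm dot_xy.
suff <- : \sum_j ((xcoord z j / tnth r j) ^+ 2 + (ycoord z j / tnth r j) ^+ 2)
   = \sum_j (xcoord (dbl (fun j => (tnth r j)^-1) *m z) j *
             xcoord (dbl (fun j => (tnth r j)^-1) *m z) j +
             ycoord (dbl (fun j => (tnth r j)^-1) *m z) j *
             ycoord (dbl (fun j => (tnth r j)^-1) *m z) j) by [].
by apply: eq_bigr => j _; rewrite dbl_x dbl_y; ring.
Qed.

Lemma dblV_l r : (forall j, 0 < r j) -> dbl (fun j => (r j)^-1) *m dbl r = 1%:M.
Proof.
move=> r0; apply: bilinear_eq => u v; congr (dot u _); rewrite mul1mx -mulmxA.
by apply: xy_inj => j; rewrite !(dbl_x, dbl_y) mulKf ?gt_eqF.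
Qed.

(** [c] is the least singular value of [K]. *)
Definition min_stretch m (K : 'M[R]_m) (c : R) : Prop :=
  (forall u, c * enorm u <= enorm (K *m u)) /\
  (exists2 u, u != 0 & enorm (K *m u) = c * enorm u).

Lemma min_stretch_le m (K : 'M[R]_m) c c' :
  min_stretch K c -> min_stretch K c' -> c <= c'.
Proof.
move=> [h _] [_ [u u0 e]].
by have := h u; rewrite e ler_pM2r ?enorm_gt0.
Qed.

End Williamson.
Arguments Jmx {R n}.

(** * The width as a least singular value *)

Section Spectrum.
Variable R : realType.

Lemma enorm_orth m (U : 'M[R]_m) v : U^T *m U = 1%:M -> enorm (U *m v) = enorm v.
Proof. by move=> OO; rewrite !enormE dot_mulmxl mulmxA OO mul1mx. Qed.

Lemma dbl_J_dbl n (r : 'I_n -> R) : dbl r *m Jmx *m dbl r =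
  block_mx 0 (diag_mx (\row_j r j ^+ 2)) (- diag_mx (\row_j r j ^+ 2)) 0.
Proof.
rewrite /dbl /Jmx diag_mx_row !mulmx_block.
rewrite !mulmx0 !mul0mx !add0r !addr0 !mulmx1 !mul0mx !mulmxN !mulNmx !mulmx1.
rewrite mulmx_diag ?oppr0.
by congr (block_mx _ (diag_mx _) (- diag_mx _) _); apply/rowP => j; rewrite !mxE.
Qed.

(** The orthogonal matrix has the vectors [u_j], [v_j] of a full frame as columns.
    Minimality of [c_i] tested on the later [u_j] gives [c_i <= c_j], hence
    sorted radii [r_j = sqrt c_j]. *)
Lemma antisym_normal_form n (K : 'M[R]_(n + n)) :
  K^T = - K -> K \in unitmx ->
  exists (U : 'M[R]_(n + n)) (r : 'I_n -> R),
    [/\ U^T *m U = 1%:M, forall j, 0 < r j,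
        forall i j : 'I_n, (i <= j)%N -> r i <= r j &
        U^T *m K *m U = dbl r *m Jmx *m dbl r].
Proof.
move=> aK uK.
have [u [v [c [c0 orth Kuv cmin]]]] := exists_antisym_frame aK uK (leqnn n).
pose cols (f : nat -> 'cV[R]_(n + n)) : 'M[R]_(n + n, n) :=
  \matrix_(i < n + n, j < n) f j i 0.
have colsM f g i j : ((cols f)^T *m cols g) i j = dot (f i) (g j).
  by rewrite mxE dotE; apply: eq_bigr => k _; rewrite !mxE.
have Kcols f : K *m cols f = cols (fun j => K *m f j).
  by apply/matrixP => i j; rewrite !mxE; apply: eq_bigr => k _; rewrite !mxE.
exists (row_mx (cols u) (cols v)), (fun j => Num.sqrt (c j)); split.
- rewrite tr_row_mx mul_col_row (@scalar_mx_block _ n n).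
  congr block_mx; apply/matrixP => i j; rewrite colsM !mxE.
  + by have [-> _ _] := orth i j (ltn_ord i) (ltn_ord j).
  + by have [_ _ ->] := orth i j (ltn_ord i) (ltn_ord j).
  + by have [_ _] := orth j i (ltn_ord j) (ltn_ord i); rewrite dotC.
  + by have [_ -> _] := orth i j (ltn_ord i) (ltn_ord j).
- by move=> j; rewrite sqrtr_gt0 c0.
- move=> i j ij; apply: ler_wsqrtr.
  have [ii jj] := (ltn_ord i, ltn_ord j).
  have [uj vj _] := orth j j jj jj; rewrite eqxx in uj vj.
  have u1 : enorm (u j) = 1 by rewrite enormE uj sqrtr1.
  have v1 : enorm (v j) = 1 by rewrite enormE vj sqrtr1.
  have [Ku _] := Kuv j jj.
  have := cmin i (u j) ii; rewrite Ku enormZ normrN u1 v1 !mulr1 gtr0_norm ?c0//.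
  apply => k ki; have kj := leq_trans ki ij; have kn := ltn_trans kj jj.
  have [-> _ _] := orth k j kn jj; rewrite ltn_eqF//.
  by have [_ _] := orth j k jj kn; rewrite dotC.
- rewrite -mulmxA mul_mx_row tr_row_mx mul_col_row !Kcols dbl_J_dbl.
  congr block_mx; apply/matrixP => i j; rewrite colsM;
    have [ii jj] := (ltn_ord i, ltn_ord j); have [Ku Kv] := Kuv j jj;
    rewrite ?Ku ?Kv dotZr;
    have [uu vv uv] := orth i j ii jj; have [_ _ uv'] := orth j i jj ii.
  + by rewrite uv mulr0 mxE.
  + rewrite uu !mxE sqr_sqrtr ?ltW ?c0// mulr_natr.
    by rewrite -val_eqE; case: eqVneq => [->|_]; rewrite ?mulr0n ?oppr0.
  + rewrite vv !mxE sqr_sqrtr ?ltW ?c0// mulNr mulr_natr.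
    by rewrite -val_eqE; case: eqVneq => [->|_]; rewrite ?mulr0n ?oppr0.
  + by rewrite dotC uv' mulr0 mxE.
Qed.

Lemma dblV_r n (r : 'I_n -> R) :
  (forall j, 0 < r j) -> dbl r *m dbl (fun j => (r j)^-1) = 1%:M.
Proof. by move=> r0; rewrite mulmx1C // dblV_l. Qed.

Lemma trmx_dbl n (r : 'I_n -> R) : (dbl r)^T = dbl r.
Proof. exact: tr_diag_mx. Qed.

Lemma linmx_mulmx m (S : 'M[R]_m) :
  linmx (mulmx S : {linear 'cV[R]_m -> 'cV[R]_m}) = S.
Proof. by apply: bilinear_eq => u v; rewrite -linmxE. Qed.

(** Williamson's theorem.  For [U], [r] as in [antisym_normal_form] applied to
    [A^T J A], the matrix [diag(r, r) U^T A^-1] is symplectic and sends [E(A)]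
    to the standard ellipsoid. *)
Lemma williamson n (A : 'M[R]_(n + n)) : A \in unitmx ->
  exists r : n.-tuple R, is_symplectic_spectrum (ellipsoid A) r.
Proof.
move=> uA; pose K := A^T *m Jmx *m A.
have aK : K^T = - K.
  by rewrite /K !trmx_mul trmxK trmx_Jmx mulNmx mulmxN mulmxA.
have uK : K \in unitmx by rewrite !unitmx_mul unitmx_tr uA Jmx_unit.
have [U [r [OO r0 rle OKO]]] := antisym_normal_form aK uK.
have OO' : U *m U^T = 1%:M by rewrite mulmx1C.
pose t := [tuple r j | j < n].
have tE : tnth t = r by apply/funext => j; rewrite tnth_mktuple.
exists t; split; first by move=> j; rewrite tE.
  apply/(sortedP 0) => i; rewrite size_tuple => i1.
  have i0 := ltnW i1.
  by rewrite -(tnth_nth 0 t (Ordinal i0)) -(tnth_nth 0 t (Ordinal i1)) tE rle/=.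
pose S := dbl r *m U^T *m invmx A.
have SA : S *m A = dbl r *m U^T by rewrite mulmxKV.
exists (mulmx S : {linear 'cV[R]_(n + n) -> 'cV[R]_(n + n)}).
  apply/symplecticP; rewrite linmx_mulmx.
  pose T := dbl r *m U^T.
  have TT : T^T *m Jmx *m T = K.
    rewrite /T trmx_mul trmxK trmx_dbl !mulmxA -2!(mulmxA U) -OKO !mulmxA OO'.
    by rewrite mul1mx -mulmxA OO' mulmx1.
  rewrite /S -/T; clearbody T.
  rewrite trmx_mul !mulmxA -2!(mulmxA (invmx A)^T) TT /K !mulmxA mulmxK//.
  by rewrite -trmx_mul mulmxV// trmx1 mul1mx.
apply/seteqP; split => z.
  move=> [_ [b b1 <-] <-]; apply/std_ellipsoidE.
  by rewrite tE /= (mulmxA S) SA !mulmxA dblV_l// mul1mx enorm_orth ?trmxK.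
move=> /std_ellipsoidE; rewrite tE => z1.
pose b := U *m (dbl (fun j => (r j)^-1) *m z).
exists (A *m b); first by exists b => //; rewrite /eball /= enorm_orth.
rewrite /= (mulmxA S) SA /b -!mulmxA (mulmxA U^T) OO mul1mx mulmxA dblV_r//.
by rewrite mul1mx.
Qed.

Lemma isometry_orth m (Q : 'M[R]_m) :
  (forall x, enorm (Q *m x) = enorm x) -> Q^T *m Q = 1%:M.
Proof.
move=> h; apply: bilinear_eq => u v.
have sq x : dot (Q *m x) (Q *m x) = dot x x by rewrite -!sqr_enorm h.
rewrite -mulmxA -dot_mulmxl mul1mx.
have := sq (u + v); rewrite mulmxDr !dot_lin !sq (dotC (Q *m v)) (dotC v).
lra.
Qed.

(** Neither [Q] nor its inverse increases norms. *)
Lemma unit_ball_onto_isometry m (Q : 'M[R]_m) :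
  Q \in unitmx -> (forall x, enorm x <= 1 -> enorm (Q *m x) <= 1) ->
  (forall y, enorm y <= 1 -> exists2 x, enorm x <= 1 & Q *m x = y) ->
  forall x, enorm (Q *m x) = enorm x.
Proof.
move=> uQ Q1 Qs x; apply/eqP; rewrite eq_le; apply/andP; split.
  by rewrite -[leRHS]mul1r; apply: ball_bound.
rewrite -{1}[x](mulKmx uQ) -[leRHS]mul1r; apply: ball_bound => y y1.
by have [z z1 <-] := Qs y y1; rewrite mulKmx.
Qed.

(** With [D = diag(r, r)], the matrix [Q = D^-1 Psi A] maps the unit ball onto
    itself, so it is orthogonal, and [A^T J A = Q^T (D J D) Q].  The singular
    values of [D J D] are the [r_j^2]; the smallest is attained at the first
    coordinate vector. *)
Lemma spectrum_min_stretch n (A : 'M[R]_(n + n)) (r : n.-tuple R) :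
  (0 < n)%N -> A \in unitmx -> is_symplectic_spectrum (ellipsoid A) r ->
  min_stretch (A^T *m Jmx *m A) (r`_0 ^+ 2).
Proof.
move=> n0 uA [r0 rs [Psi /symplecticP sP imE]].
set P := linmx Psi in sP.
have uP : P \in unitmx.
  have : P^T *m Jmx *m P \in unitmx by rewrite sP Jmx_unit.
  by rewrite unitmx_mul => /andP[].
pose D := dbl (tnth r); pose D' := dbl (fun j => (tnth r j)^-1).
have DD' : D *m D' = 1%:M by exact: dblV_r.
have D'D : D' *m D = 1%:M by exact: dblV_l.
pose Q := D' *m P *m A.
have PA : P *m A = D *m Q by rewrite /Q !mulmxA DD' mul1mx.
have uQ : Q \in unitmx.
  by rewrite !unitmx_mul uP uA !andbT; have [] := mulmx1_unit D'D.
have isoQ x : enorm (Q *m x) = enorm x.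
  apply: unit_ball_onto_isometry => // {}x x1.
    have /std_ellipsoidE : std_ellipsoid r (Psi (A *m x)).
      by rewrite -imE; exists (A *m x) => //; exists x.
    by rewrite (linmxE Psi) !mulmxA.
  have : std_ellipsoid r (D *m x) by apply/std_ellipsoidE; rewrite mulmxA D'D mul1mx.
  rewrite -imE => -[_ [b b1 <-]]; rewrite (linmxE Psi) => e.
  exists b => //.
  by rewrite /Q -2!mulmxA e mulmxA D'D mul1mx.
have QQ := isometry_orth isoQ; have QQ' : Q *m Q^T = 1%:M by exact: mulmx1C.
pose E := D *m Jmx *m D.
have KE : A^T *m Jmx *m A = Q^T *m (E *m Q).
  rewrite -sP !mulmxA -trmx_mul -[_ *m P *m A]mulmxA PA trmx_mul trmx_dbl.
  by rewrite /E !mulmxA.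
have nK u : enorm (A^T *m Jmx *m A *m u) = enorm (E *m (Q *m u)).
  by rewrite KE -!mulmxA enorm_orth// trmxK.
have r00 : 0 <= r`_0 by rewrite -(tnth_nth 0 r (Ordinal n0)) ltW.
have rmin j : r`_0 <= tnth r j.
  rewrite (tnth_nth 0); have := leq0n j; rewrite leq_eqVlt => /predU1P[<-//|j0].
  by apply: (sorted_ltn_nth le_trans) => //; rewrite inE size_tuple.
have nE y : dot (E *m y) (E *m y) =
    \sum_j ((tnth r j ^+ 2 * xcoord y j) ^+ 2 + (tnth r j ^+ 2 * ycoord y j) ^+ 2).
  rewrite dot_xy; apply: eq_bigr => j _.
  by rewrite /E -!mulmxA !(dbl_x, dbl_y, J_x, J_y); ring.
split=> [u|].
  rewrite nK -(isoQ u); set y := Q *m u.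
  rewrite -(ler_pXn2r (n := 2)) ?nnegrE ?enorm_ge0 ?mulr_ge0 ?enorm_ge0 ?exprn_ge0//.
  rewrite exprMn !sqr_enorm nE dot_xy mulr_sumr; apply: ler_sum => j _.
  have h : (r`_0 ^+ 2) ^+ 2 <= (tnth r j ^+ 2) ^+ 2.
    by rewrite -!exprM lerXn2r ?nnegrE ?rmin// ltW.
  rewrite !exprMn mulrDr -!expr2.
  by rewrite lerD// ler_wpM2r ?sqr_ge0.
pose e : 'cV[R]_(n + n) := delta_mx (lshift n (Ordinal n0)) 0.
exists (Q^T *m e).
  apply/eqP => Qe0; have /eqP := @delta_neq0 R _ (lshift n (Ordinal n0)).
  by apply; rewrite -/e -[e]mul1mx -QQ' -mulmxA Qe0 mulmx0.
rewrite nK (mulmxA Q) QQ' mul1mx (enorm_orth (U := Q^T)) ?trmxK//.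
rewrite -[r`_0 ^+ 2]ger0_norm ?exprn_ge0// -enormZ !enormE; congr Num.sqrt.
rewrite nE dot_xy; apply: eq_bigr => j _.
have -> : xcoord (r`_0 ^+ 2 *: e) j = tnth r j ^+ 2 * xcoord e j.
  rewrite /xcoord !mxE (inj_eq (@lshift_inj _ _)) eqxx andbT.
  case: eqVneq => [->|_]; last by rewrite !mulr0.
  by rewrite (tnth_nth 0).
have -> : ycoord e j = 0 by rewrite /ycoord mxE eq_rlshift.
have -> : ycoord (r`_0 ^+ 2 *: e) j = 0.
  by rewrite /ycoord !mxE eq_rlshift mulr0.
by rewrite !mulr0 expr0n -expr2.
Qed.

(** The width exists by Williamson's theorem, and is unique because its square is
    the least singular value of a matrix that depends on [A] only. *)
Lemma width_satisfies n (A : 'M[R]_(n + n)) (P : R -> Prop) :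
  (0 < n)%N -> A \in unitmx ->
  (forall w, 0 < w -> min_stretch (A^T *m Jmx *m A) (w ^+ 2) -> P w) ->
  linear_symplectic_width_satisfies (ellipsoid A) P.
Proof.
move=> n0 uA hP; have [r rs] := williamson uA.
have pos (s : n.-tuple R) : is_symplectic_spectrum (ellipsoid A) s -> 0 < s`_0.
  by move=> [s0 _ _]; rewrite -(tnth_nth 0 s (Ordinal n0)).
exists r`_0; last by apply: hP; [exact: pos|exact: spectrum_min_stretch].
split; first by exists r.
move=> _ [s ss ->]; apply/eqP.
rewrite -(eqrXn2 (n := 2))// ?ltW ?pos// eq_le.
have hr := spectrum_min_stretch n0 uA rs; have hs := spectrum_min_stretch n0 uA ss.
by rewrite (min_stretch_le hr hs) (min_stretch_le hs hr).
Qed.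

End Spectrum.

(** * Perturbation of the symplectic form *)

Section Comparison.
Variable R : realType.

(** The Frobenius norm counts each coefficient of the two-form twice, which is
    where the factor [sqrt 2] comes from. *)
Lemma fnorm_antisym m (M : 'M[R]_m) : M^T = - M ->
  fnorm M = Num.sqrt 2 * two_form_norm (fun u v => dot u (M *m v)).
Proof.
move=> aM; have anti i k : M i k = - M k i.
  by have /matrixP/(_ k i) := aM; rewrite !mxE.
have diag i : M i i = 0 by have := anti i i; lra.
have eM i k : dot (delta_mx i 0) (M *m delta_mx k 0) = M i k.
  by rewrite /dot trmx_delta -colE -rowE !mxE.
rewrite /two_form_norm -sqrtrM ?ler0n//; congr Num.sqrt.
under [in RHS]eq_bigr do under eq_bigr do rewrite eM.
set S := (X in _ = 2 * X).
have lower : \sum_(i < m) \sum_(k < m | (k < i)%N) M i k ^+ 2 = S.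
  rewrite (exchange_big_dep xpredT)//=; apply: eq_bigr => i _.
  by apply: eq_bigr => k _; rewrite anti sqrrN.
rewrite mulr2n mulrDl mul1r -{2}lower /S -big_split /=; apply: eq_bigr => i _.
rewrite (bigID (fun k : 'I_m => (i < k)%N)) /=; congr (_ + _).
rewrite (bigD1 i) ?ltnn//= diag expr0n add0r; apply: eq_bigl => k.
by rewrite -leqNgt ltn_neqAle andbC.
Qed.

(** Since [J^-1 = - J], the factor [Y] relates the antisymmetric matrices of [A]
    for the forms [J + M] and [J].  Write [b = A u] and [a = A (Y u) = b - J M b].
    Then [u - Y u = A^-1 J M b] has norm at most [||A^-1|| e |b|].  The two bounds
    estimate [|b|] by [|u|], and by [|Y u|] through [|b| <= |a| + e |b|]. *)
Lemma mx_perturbation n (A M : 'M[R]_(n + n)) e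
    (Y := 1%:M - invmx A *m Jmx *m M *m A)
    (k := opnorm (invmx A) * outer_radius A) :
  (0 < n)%N -> A \in unitmx -> 0 <= e < 1 ->
  (forall v, enorm (M *m v) <= e * enorm v) ->
  [/\ A^T *m (Jmx + M) *m A = A^T *m Jmx *m A *m Y,
      forall u, enorm (Y *m u) <= (1 + k * e) * enorm u &
      forall u, enorm u <= (1 + k * (e / (1 - e))) * enorm (Y *m u)].
Proof.
move=> n0 uA /andP[e0 e1] Me.
have opA0 : 0 <= opnorm (invmx A).
  have d0 := delta_neq0 R (lshift n (Ordinal n0)).
  have := enorm_mulmx_opnorm (invmx A) (delta_mx (lshift n (Ordinal n0)) 0).
  by move/(le_trans (enorm_ge0 _)); rewrite pmulr_lge0 ?enorm_gt0.
have err u : enorm (invmx A *m Jmx *m M *m A *m u) <=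
    opnorm (invmx A) * (e * enorm (A *m u)).
  rewrite -!mulmxA (le_trans (enorm_mulmx_opnorm _ _))// ler_wpM2l//.
  by rewrite enorm_Jmx Me.
split.
- rewrite /Y mulmxBr mulmx1 mulmxDr mulmxDl !mulmxA (mulmxK uA).
  by rewrite -[A^T *m Jmx *m Jmx]mulmxA Jmx_sqr mulmxN mulmx1 !mulNmx opprK.
- move=> u; rewrite mulmxBl mul1mx (le_trans (enormB _ _))// mulrDl mul1r.
  rewrite lerD2l (le_trans (err u))// /k -!mulrA ler_wpM2l// mulrCA ler_wpM2l//.
  exact: enorm_mulmx_outer_radius.
- move=> u; set w := Y *m u.
  have -> : u = w + invmx A *m Jmx *m M *m A *m u.
    by rewrite /w mulmxBl mul1mx subrK.
  rewrite (le_trans (enormD _ _))// mulrDl mul1r lerD2l (le_trans (err u))//.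
  have Aw : A *m w = A *m u - Jmx *m (M *m (A *m u)).
    by rewrite /w /Y (mulmxA A) mulmxBr mulmx1 mulmxBl !mulmxA mulmxV// mul1mx.
  have Auw : enorm (A *m u) <= (1 - e)^-1 * (outer_radius A * enorm w).
    rewrite ler_pdivlMl ?subr_gt0// (le_trans _ (enorm_mulmx_outer_radius A w))//.
    rewrite mulrBl mul1r lerBlDr (le_trans _ (lerD (lexx _) (Me _)))//.
    rewrite -(enorm_Jmx (M *m _)) (le_trans _ (enormD _ _))//.
    by rewrite Aw subrK.
  rewrite (_ : k * (e / (1 - e)) * enorm w =
    opnorm (invmx A) * (e * ((1 - e)^-1 * (outer_radius A * enorm w)))).
    by rewrite !ler_wpM2l.
  by rewrite /k; ring.
Qed.

Lemma rho_facts (e : R) : 0 <= e < 1 ->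
  [/\ 0 < rho e, rho e <= 1 & rho e ^+ 2 = 1 - e].
Proof.
move=> /andP[e0 e1]; have e10 : 0 < 1 - e by rewrite subr_gt0.
rewrite /rho sqrtr_gt0 e10 sqr_sqrtr ?(ltW e10)//; split=> //.
by rewrite -[leRHS]sqrtr1 ler_wsqrtr// gerBl.
Qed.

(** With [t = rho^-1 - 1] one has [e / (1 - e) = t^2 + 2 t], and the difference
    of the two sides is [k (k - 1) t^2]. *)
Lemma squeeze_bound (e k : R) : 0 <= e < 1 -> 1 <= k ->
  1 + k * (e / (1 - e)) <= (1 + k * ((rho e)^-1 - 1)) ^+ 2.
Proof.
move=> he k1; have [r0 r1 r2] := rho_facts he.
set t := (rho e)^-1 - 1.
have -> : e / (1 - e) = t ^+ 2 + 2 * t.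
  rewrite -r2 {1}(_ : e = 1 - rho e ^+ 2); last by rewrite r2; ring.
  by rewrite /t; field; rewrite gt_eqF.
rewrite -subr_ge0 (_ : _ - _ = k * (k - 1) * t ^+ 2); last by ring.
by rewrite mulr_ge0 ?sqr_ge0 ?mulr_ge0 ?subr_ge0// (le_trans _ k1).
Qed.

(** With [t = rho^-1 - 1] one has [e <= 2 t], and with [x = k t] the claim reduces
    to [(1 - x)^2 (1 + 2 x) = 1 - x^2 (3 - 2 x) <= 1]. *)
Lemma expand_bound (e k : R) : 0 <= e < 1 -> 0 <= k -> k * ((rho e)^-1 - 1) < 1 ->
  (1 - k * ((rho e)^-1 - 1)) ^+ 2 * (1 + k * e) <= 1.
Proof.
move=> he k0; have [r0 r1 r2] := rho_facts he.
set t := (rho e)^-1 - 1 => kt1.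
have t0 : 0 <= t by rewrite subr_ge0 invf_ge1.
have et : e <= 2 * t.
  have {1}-> : e = t * (rho e * (1 + rho e)).
    transitivity (1 - rho e ^+ 2); first by rewrite r2; ring.
    by rewrite /t; field; rewrite gt_eqF.
  by rewrite mulrC ler_wpM2r//; nra.
have x0 : 0 <= k * t by rewrite mulr_ge0.
apply: (@le_trans _ _ ((1 - k * t) ^+ 2 * (1 + 2 * (k * t)))).
  by rewrite ler_wpM2l ?sqr_ge0// lerD2l mulrCA ler_wpM2l.
move: (k * t) x0 kt1 => x x0 x1.
rewrite -subr_ge0 (_ : _ - _ = x ^+ 2 * (3 - 2 * x)); last by ring.
by rewrite mulr_ge0 ?sqr_ge0//; lra.
Qed.

End Comparison.

(** * Non-squeezing and non-expanding *)

Lemma image_ellipsoid (R : realType) m (Phi : {linear 'cV[R]_m -> 'cV[R]_m})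
    (A : 'M[R]_m) :
  Phi @` ellipsoid A = ellipsoid (linmx Phi *m A).
Proof.
apply/seteqP; split => [_ [_ [b b1 <-] <-]|_ [b b1 <-]].
  by exists b => //; rewrite (linmxE Phi) mulmxA.
exists (A *m b); first by exists b.
by rewrite (linmxE Phi) mulmxA.
Qed.

Lemma eball_ellipsoid (R : realType) m (r : R) : 0 < r ->
  @eball R m r = ellipsoid (r%:M).
Proof.
move=> r0; apply/seteqP; split => v.
  move=> v1; exists (r^-1 *: v).
    rewrite /eball /= enormZ ger0_norm ?invr_ge0 ?(ltW r0)//.
    by rewrite ler_pdivrMl// mulr1.
  by rewrite mul_scalar_mx scalerA divff ?scale1r// gt_eqF.
move=> [b b1 <-]; rewrite /eball /= mul_scalar_mx enormZ ger0_norm ?(ltW r0)//.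
by rewrite -[leRHS]mulr1 ler_wpM2l// ltW.
Qed.

Lemma eps_symplectic_perturbation (R : realType) n (eps : R)
    (Phi : {linear 'cV[R]_(n + n) -> 'cV[R]_(n + n)}) :
  0 <= eps -> eps_symplectic eps Phi ->
  exists2 M : 'M[R]_(n + n),
    (linmx Phi)^T *m Jmx *m linmx Phi = Jmx + M &
    forall v, enorm (M *m v) <= Num.sqrt 2 * eps * enorm v.
Proof.
move=> eps0 hPhi; set P := linmx Phi.
exists (P^T *m Jmx *m P - Jmx); first by rewrite addrC subrK.
set M := _ - _.
have aM : M^T = - M.
  rewrite /M linearB /= !trmx_mul trmxK trmx_Jmx mulNmx mulmxN mulmxA.
  by rewrite opprB opprK addrC.
move=> v; rewrite (le_trans (enorm_mulmx_fnorm _ _))//.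
rewrite ler_wpM2r ?enorm_ge0// (fnorm_antisym aM) ler_wpM2l ?sqrtr_ge0//.
rewrite (le_trans _ hPhi)// le_eqVlt; apply/orP; left; apply/eqP.
congr (two_form_norm _); apply/funext => x; apply/funext => y.
rewrite /pullback !omega0E !(linmxE Phi) -/P dot_mulmxl !mulmxA.
by rewrite -dotNr -dotDr mulmxBl.
Qed.

Theorem proposition1p4 (R : realType) (n : nat) (hn : (0 < n)%N) (eps : R)
  (heps0 : 0 <= eps) (heps1 : eps < 1 / Num.sqrt 2)
  (Phi : {linear 'cV[R]_(n + n) -> 'cV[R]_(n + n)})
  (hPhi : eps_symplectic eps Phi) :
  linear_non_squeezing (Num.sqrt 2 * eps) Phi /\
  linear_non_expanding (Num.sqrt 2 * eps) Phi.
Proof.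
have [M PJP Me] := eps_symplectic_perturbation heps0 hPhi.
set e := Num.sqrt 2 * eps in Me *; set P := linmx Phi in PJP.
have s2 : 0 < Num.sqrt 2 :> R by rewrite sqrtr_gt0 ltr0n.
have e01 : 0 <= e < 1.
  by rewrite /e mulr_ge0 ?(ltW s2)//= mulrC -ltr_pdivlMr.
have [e0 e1] := andP e01.
have [rho0 rho1 rho2] := rho_facts e01.
(* [J] is isometric and [M] contracts, so [J + M = P^T J P] is injective. *)
have uP : P \in unitmx.
  suff : Jmx + M \in unitmx by rewrite -PJP unitmx_mul => /andP[].
  apply: unitmx_inj => w /eqP; rewrite mulmxDl addr_eq0 => /eqP JMw.
  have := Me w; rewrite -[M *m w]opprK -JMw enormN enorm_Jmx => we.
  apply: enorm_eq0; have := enorm_ge0 w; nra.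
have K'E (A : 'M[R]_(n + n)) :
    (P *m A)^T *m Jmx *m (P *m A) = A^T *m (Jmx + M) *m A.
  by rewrite -PJP trmx_mul !mulmxA.
have widthP (A : 'M[R]_(n + n)) (Q : R -> Prop) : A \in unitmx ->
    (forall w, 0 < w -> min_stretch (A^T *m (Jmx + M) *m A) (w ^+ 2) -> Q w) ->
    linear_symplectic_width_satisfies (Phi @` ellipsoid A) Q.
  move=> uA h; rewrite image_ellipsoid; apply: width_satisfies => //.
    by rewrite unitmx_mul uP.
  by move=> w w0; rewrite K'E; exact: h.
have width1 (A : 'M[R]_(n + n)) r1 : A \in unitmx ->
    is_linear_symplectic_width (ellipsoid A) r1 ->
    0 < r1 /\ min_stretch (A^T *m Jmx *m A) (r1 ^+ 2).
  move=> uA [r rs ->]; split; last exact: spectrum_min_stretch.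
  by case: rs => r0 _ _; rewrite -(tnth_nth 0 r (Ordinal hn)).
have n2 : (0 < n + n)%N by rewrite addn_gt0 hn.
have distE (A : 'M[R]_(n + n)) : distortion e A =
    opnorm (invmx A) * outer_radius A * ((rho e)^-1 - 1).
  by rewrite /distortion mulrAC.
have t0 : 0 <= (rho e)^-1 - 1 by rewrite subr_ge0 invf_ge1.
split; [|split].
- move=> A r1 uA /(width1 _ _ uA)[r10 [Kge _]]; apply: widthP => // w w0.
  move=> [_ [u u0 K'u]].
  have [K'Y _ uY] := mx_perturbation hn uA e01 Me.
  have k1 := opnorm_outer_ge1 n2 uA.
  rewrite /squeeze_factor distE.
  set k := opnorm _ * _ in uY k1 *; set t := _ - 1 in t0 *.
  have k0 : 0 <= k by rewrite (le_trans _ k1).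
  have kt : 0 < 1 + k * t by rewrite ltr_pwDl// mulr_ge0.
  have ke : 0 <= e / (1 - e) by rewrite divr_ge0// subr_ge0 ltW.
  have c0 : 0 <= 1 + k * (e / (1 - e)) by rewrite addr_ge0// (mulr_ge0 k0 ke).
  (* [u] realises the least singular value of [K' = K Y]. *)
  have r1w : r1 ^+ 2 <= (1 + k * (e / (1 - e))) * w ^+ 2.
    rewrite -(ler_pM2r (enorm_gt0 u0)) (le_trans (ler_wpM2l (sqr_ge0 _) (uY u)))//.
    by rewrite mulrCA -[leRHS]mulrA ler_wpM2l// -K'u K'Y -(mulmxA _ _ u) Kge.
  rewrite ler_pdivrMl// -(ler_pXn2r (n := 2))
    ?nnegrE ?(mulr_ge0 (ltW kt)) ?(ltW r10) ?(ltW w0)//.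
  by rewrite exprMn (le_trans r1w)// ler_wpM2r ?sqr_ge0// squeeze_bound.
- move=> r r0; rewrite eball_ellipsoid//.
  have ur : (r%:M : 'M[R]_(n + n)) \in unitmx
    by rewrite unitmxE det_scalar unitrX// unitfE gt_eqF.
  apply: widthP => // w w0 [K'ge _].
  rewrite -(ler_pXn2r (n := 2))
    ?nnegrE ?mulr_ge0 ?invr_ge0 ?(ltW r0) ?(ltW rho0) ?(ltW w0)//.
  pose u : 'cV[R]_(n + n) := delta_mx (lshift n (Ordinal hn)) 0.
  have u0 : 0 < enorm u by apply: enorm_gt0; exact: delta_neq0.
  have Ku : (r%:M)^T *m (Jmx + M) *m r%:M *m u = r ^+ 2 *: ((Jmx + M) *m u).
    by rewrite tr_scalar_mx mul_scalar_mx mul_mx_scalar -!scalemxAl scalerA.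
  have nJM : enorm ((Jmx + M) *m u) <= (1 + e) * enorm u.
    by rewrite mulmxDl (le_trans (enormD _ _))// enorm_Jmx mulrDl mul1r lerD2l.
  (* Every direction is stretched by at most [r^2 (1 + e)], so any [u] will do;
     then [1 + e <= (1 - e)^-1 = rho^-2]. *)
  have w2 : w ^+ 2 <= r ^+ 2 * (1 + e).
    rewrite -(ler_pM2r u0) (le_trans (K'ge u))// Ku enormZ ger0_norm ?sqr_ge0//.
    by rewrite -[leRHS]mulrA ler_wpM2l ?sqr_ge0.
  rewrite (le_trans w2)// exprMn exprVn rho2 mulrC ler_wpM2r ?sqr_ge0//.
  rewrite -div1r ler_pdivlMr ?subr_gt0//; nra.
- move=> A r1 uA /(width1 _ _ uA)[r10 [_ [v v0 Kv]]] dist1.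
  apply: widthP => // w w0 [K'ge _].
  have [K'Y Yle uY] := mx_perturbation hn uA e01 Me.
  have k1 := opnorm_outer_ge1 n2 uA.
  move: dist1; rewrite /expand_factor distE.
  set k := opnorm _ * _ in uY Yle k1 *; set Y := (1%:M - _) in uY Yle K'Y.
  move=> kt1.
  have k0 : 0 <= k by rewrite (le_trans _ k1).
  have eb := expand_bound e01 k0 kt1.
  set t := _ - 1 in t0 kt1 eb *.
  have kt : 0 < 1 - k * t by rewrite subr_gt0.
  have uYm : Y \in unitmx.
    apply: unitmx_inj => x Yx; apply: enorm_eq0; apply/eqP.
    by rewrite eq_le enorm_ge0 andbT (le_trans (uY x))// Yx enorm0 mulr0.
  (* [v] realises the least singular value of [K]; it is tested on [K' = K Y]
     through its preimage under [Y]. *)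
  pose u := invmx Y *m v; have Yu : Y *m u = v by rewrite /u mulKVmx.
  have u0 : 0 < enorm u.
    by apply: enorm_gt0; apply: contraNneq v0 => u0; rewrite -Yu u0 mulmx0.
  have r1w : w ^+ 2 <= r1 ^+ 2 * (1 + k * e).
    rewrite -(ler_pM2r u0) (le_trans (K'ge u))//.
    rewrite K'Y -(mulmxA _ _ u) Yu Kv -[leRHS]mulrA.
    by rewrite ler_wpM2l ?sqr_ge0// -Yu.
  rewrite ler_pdivlMl// -(ler_pXn2r (n := 2))
    ?nnegrE ?mulr_ge0 ?(ltW kt) ?(ltW r10) ?(ltW w0)//.
  rewrite exprMn (le_trans (ler_wpM2l (sqr_ge0 _) r1w))// mulrCA.
  by rewrite -[leRHS]mulr1 ler_wpM2l ?sqr_ge0.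
Qed.
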